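(* Let $E, F$ be Riesz spaces and $T \in \mathcal{O}(E,F)$. If for every $x \in E$ the supremum $R(x) := \sup \{T(u): \, u \sqsubseteq x\}$ exists in $F$, then $T^+$ exists in $\mathcal{O}(E,F)$ and $T^+ = R$. Moreover, in the case of existence (of the suprema $R(x)$ for all $x\in E$) the following hold. (1) If $T \in \mathcal{P}(E,F)$ then $T^+ \in \mathcal{P}(E,F)$. (2) If $T \in \mathcal{U}(E,F)$ then $T^+ \in \mathcal{U}(E,F)$.
   Context: A Riesz space is a real vector lattice (no Dedekind completeness or Archimedean property is assumed); $x \perp y$ (disjointness) means $|x| \wedge |y| = 0$. An element $x$ is a fragment of $y$, written $x \sqsubseteq y$, if $x \perp y - x$; $\mathfrak{F}_e$ is the set of all fragments of $e$. A function $T \colon E \to F$ is an orthogonally additive operator (OAO) if $T(x+y) = T(x) + T(y)$ for all disjoint $x,y \in E$. $\mathcal{O}(E,F)$ is the vector space of all OAOs, ordered by $S \le T$ iff $S(x) \le T(x)$ for all $x \in E$; $T^+ := T \vee 0$ is the least upper bound of $T$ and $0$ in this ordered vector space. $\mathcal{P}(E,F)$ is the set of laterally-to-order bounded OAOs, i.e. those $T$ for which $T(\mathfrak{F}_e)$ is order bounded in $F$ for every $e \in E$. $\mathcal{U}(E,F)$ is the set of order bounded OAOs (abstract Uryson operators), i.e. those sending order bounded subsets of $E$ to order bounded subsets of $F$. *)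

(* Defs.v *)
From HB Require Import structures.
From mathcomp Require Import all_boot all_order all_algebra.
From mathcomp Require Import boolp classical_sets functions reals.
Set Implicit Arguments.
Unset Strict Implicit.
Unset Printing Implicit Defensive.
Import Order.TTheory GRing.Theory Num.Theory.
Local Open Scope classical_set_scope.
Local Open Scope ring_scope.

(* The lattice operations are fields of the mixin, rather than inherited from
   Order.Lattice, because Hierarchy Builder refuses a new structure joining
   Order.Lattice with an additive structure (Num.RealDomain has both). *)
HB.mixin Record isRiesz (R : realType) V
    of GRing.Lmodule R V & Order.POrder ring_display V := {
  riesz_leD2r : forall x y z : V, x <= y -> x + z <= y + z ;
  riesz_scale_ge0 : forall (a : R) (x : V), 0 <= a -> 0 <= x -> 0 <= a *: x ;
  riesz_meet : V -> V -> V ;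
  riesz_join : V -> V -> V ;
  riesz_meetP : forall x y z : V,
    (x <= riesz_meet y z) = (x <= y) && (x <= z) ;
  riesz_joinP : forall x y z : V,
    (riesz_join x y <= z) = (x <= z) && (y <= z) }.

#[short(type="rieszType")]
HB.structure Definition Riesz (R : realType) :=
  { V of GRing.Lmodule R V & Order.POrder ring_display V & isRiesz R V }.

HB.instance Definition _ (R : realType) (V : rieszType R) :=
  Order.POrder_MeetJoin_isLattice.Build ring_display (Riesz.sort V)
    (@riesz_meetP R V) (@riesz_joinP R V).

Section RieszDefs.
Context {R : realType} {E : rieszType R}.
Implicit Types x y e : E.

Definition rabs x : E := (x `|` (- x)%R)%O.

Definition disjointv x y : Prop := (rabs x `&` rabs y)%O = 0.

Definition fragment x y : Prop := disjointv x (y - x).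

Definition fragments e : set E := [set x | fragment x e].

Definition order_bounded (A : set E) : Prop :=
  exists a b : E, A `<=` [set x | a <= x <= b].

End RieszDefs.

Definition orthogonally_additive {R : realType} {E F : rieszType R}
    (T : E -> F) : Prop :=
  forall x y : E, disjointv x y -> T (x + y) = T x + T y.

Definition oao_pred {R : realType} (E F : rieszType R) : {pred E -> F} :=
  [pred T : E -> F | `[< orthogonally_additive T >]].
Arguments oao_pred {R} E F.

Record oao (R : realType) (E F : rieszType R) := Oao {
  oao_fun :> E -> F ;
  oao_funP : oao_fun \in oao_pred E F }.

Section OaoSpace.
Context {R : realType} {E F : rieszType R}.

HB.instance Definition _ := [isSub for @oao_fun R E F].
HB.instance Definition _ := [Choice of oao E F by <:].

Lemma oao_submod_closed : submod_closed (oao_pred E F).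
Proof.
split; first by apply/asboolP => x y _; rewrite /= addr0.
move=> a S T /asboolP addS /asboolP addT; apply/asboolP => x y dxy.
rewrite !fctE addS// addT// scalerDr.
by rewrite !addrA; congr (_ + _); rewrite -!addrA; congr (_ + _); rewrite addrC.
Qed.
HB.instance Definition _ :=
  GRing.isSubmodClosed.Build R (E -> F) (oao_pred E F) oao_submod_closed.
HB.instance Definition _ :=
  [SubChoice_isSubLmodule of oao E F by <:].

Definition le_oao (S T : oao E F) : bool := `[< forall x : E, S x <= T x >].

Lemma le_oao_refl : reflexive le_oao.
Proof. by move=> T; apply/asboolP. Qed.

Lemma le_oao_anti : antisymmetric le_oao.
Proof.
move=> S T /andP[/asboolP leST /asboolP leTS]; apply/val_inj/funext => x.
by apply/le_anti; rewrite leST leTS.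
Qed.

Lemma le_oao_trans : transitive le_oao.
Proof.
move=> T S U /asboolP leST /asboolP leTU; apply/asboolP => x.
exact: le_trans (leST x) (leTU x).
Qed.

HB.instance Definition _ := Order.Le_isPOrder.Build ring_display (oao E F)
  le_oao_refl le_oao_anti le_oao_trans.

Lemma oao_leP (S T : oao E F) : S <= T <-> forall x : E, S x <= T x.
Proof. by split=> [/asboolP|] //; move/asboolP. Qed.

Lemma oao0E (x : E) : (0 : oao E F) x = 0.
Proof. by []. Qed.

Definition laterally_bounded_oao : set (oao E F) :=
  [set T | forall e : E, order_bounded (T @` fragments e)].

Definition uryson_oao : set (oao E F) :=
  [set T | forall A : set E, order_bounded A -> order_bounded (T @` A)].

End OaoSpace.

Arguments laterally_bounded_oao {R} E F.
Arguments uryson_oao {R} E F.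

(* Main.v *)
(* Everything rests on the decomposition of fragments: if [x] and [y] are
   disjoint, the fragments of [x + y] are exactly the sums [u + v] of a fragment
   [u] of [x] and a fragment [v] of [y]. Since such [u] and [v] are disjoint,
   [T (u + v) = T u + T v], so [R x = sup {T u : u fragment of x}] is
   orthogonally additive. Any orthogonally additive [S] above [T] and [0]
   satisfies [T u <= S u <= S u + S (x - u) = S x], whence [R <= S].
   Positivity and additivity of [R] alone confine [R] on the fragments of [e] to
   [0, R e], and fragments of elements of an order interval stay in a fixed
   symmetric order interval, on which [T] is bounded. *)
Require Import Defs.
From mathcomp Require Import all_boot all_order all_algebra.
From mathcomp Require Import boolp classical_sets functions reals.
Import Order.TTheory GRing.Theory Num.Theory.
Local Open Scope classical_set_scope.
Local Open Scope ring_scope.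

Section RieszTheory.
Set Implicit Arguments.
Unset Strict Implicit.
Context {K : realType} {E : rieszType K}.
Implicit Types x y z u v w p q : E.

(** * Compatibility of the order with addition *)

Lemma riesz_lerD2r z x y : (x + z <= y + z) = (x <= y).
Proof.
apply/idP/idP => [|/(@riesz_leD2r _ E _ _ z)//].
by move/(@riesz_leD2r _ E _ _ (- z)); rewrite !addrK.
Qed.

Lemma riesz_lerD2l z x y : (z + x <= z + y) = (x <= y).
Proof. by rewrite ![z + _]addrC riesz_lerD2r. Qed.

Lemma riesz_lerD x y u v : x <= y -> u <= v -> x + u <= y + v.
Proof.
by move=> xy uv; apply: (@le_trans _ _ (y + u));
  rewrite ?riesz_lerD2r ?riesz_lerD2l.
Qed.

Lemma riesz_lerBlDr x y z : (x - y <= z) = (x <= z + y).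
Proof. by rewrite -(riesz_lerD2r y (x - y)) subrK. Qed.

Lemma riesz_lerBlDl x y z : (x - y <= z) = (x <= y + z).
Proof. by rewrite riesz_lerBlDr addrC. Qed.

Lemma riesz_lerBrDr x y z : (x <= y - z) = (x + z <= y).
Proof. by rewrite -(riesz_lerD2r z x) subrK. Qed.

Lemma riesz_lerBrDl x y z : (x <= y - z) = (z + x <= y).
Proof. by rewrite riesz_lerBrDr addrC. Qed.

Lemma riesz_lerN2 x y : (- x <= - y) = (y <= x).
Proof. by rewrite -(riesz_lerD2r (x + y) (- x)) addKr addrCA addNr addr0. Qed.

Lemma riesz_lerDl x y : (x <= x + y) = (0 <= y).
Proof. by rewrite -{1}[x]addr0 riesz_lerD2l. Qed.

(** * Absolute value, meets of sums and Riesz decomposition *)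

Lemma rabs_leP x y : reflect (- y <= x /\ x <= y) (rabs x <= y).
Proof.
rewrite /rabs leUx -[y in X in _ && X]opprK riesz_lerN2 andbC.
exact: andP.
Qed.

Lemma ler_rabs x : x <= rabs x.
Proof. exact: leUl. Qed.

Lemma lerN_rabs x : - x <= rabs x.
Proof. exact: leUr. Qed.

Lemma rabsN x : rabs (- x) = rabs x.
Proof. by rewrite /rabs opprK joinC. Qed.

(** Adding [x <= rabs x] and [- x <= rabs x] makes twice [rabs x] nonnegative; scaling by 1/2
    concludes. *)
Lemma rabs_ge0 x : 0 <= rabs x.
Proof.
have h : 0 <= rabs x + rabs x.
  by rewrite -(subrr x) riesz_lerD ?ler_rabs ?lerN_rabs.
have -> : rabs x = 2^-1 *: (rabs x + rabs x).
  by rewrite -mulr2n -scaler_nat scalerA mulVf ?scale1r// pnatr_eq0.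
by apply: riesz_scale_ge0; rewrite // invr_ge0 ler0n.
Qed.

Lemma rabs0 : rabs (0 : E) = 0.
Proof. by rewrite /rabs oppr0 joinxx. Qed.

Lemma rabs_eq0 x : rabs x = 0 -> x = 0.
Proof.
move=> x0; apply/le_anti; rewrite -{1}x0 ler_rabs/=.
by rewrite -riesz_lerN2 oppr0 -x0 lerN_rabs.
Qed.

Lemma ler_rabsD x y : rabs (x + y) <= rabs x + rabs y.
Proof.
by rewrite /rabs leUx -/(rabs x) -/(rabs y) opprD !riesz_lerD
  ?ler_rabs ?lerN_rabs.
Qed.

Lemma meetD_le x y z : 0 <= x -> 0 <= y -> 0 <= z ->
  (x `&` (y + z) <= (x `&` y) + (x `&` z))%O.
Proof.
move=> x0 y0 z0; set p := (x `&` (y + z))%O.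
have px : p <= x by exact: leIl.
have pyz : p <= y + z by exact: leIr.
(* Unfolding both meets leaves [p] to be bounded by [x + x], [x + z], [y + x] and [y + z]: the last
   is [pyz], the others follow from [p <= x]. *)
rewrite -riesz_lerBlDr lexI !riesz_lerBlDl -!riesz_lerBlDr !lexI !riesz_lerBlDl.
rewrite [y + x]addrC pyz andbT.
by rewrite !(le_trans px)// riesz_lerDl.
Qed.

(* The witness [u] is [w] truncated to the order interval from [- p] to [p]. *)
Lemma riesz_decomposition w p q : 0 <= p -> 0 <= q -> rabs w <= p + q ->
  exists u v, [/\ w = u + v, rabs u <= p & rabs v <= q].
Proof.
move=> p0 q0 /rabs_leP[lw wr].
have Np0 : - p <= p by rewrite (@le_trans _ _ 0)// -oppr0 riesz_lerN2.
exists ((w `&` p) `|` (- p)%R)%O, (w - ((w `&` p) `|` (- p)%R)%O).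
split; first by rewrite addrC subrK.
- by apply/rabs_leP; rewrite leUr leUx leIr Np0.
apply/rabs_leP; split.
- rewrite riesz_lerBrDr addrC riesz_lerBlDr leUx leIxl ?riesz_lerDl//=.
  by rewrite -riesz_lerBlDr -opprD.
- rewrite riesz_lerBlDr addrC -riesz_lerBlDr lexUl// lexI !riesz_lerBlDr.
  by rewrite riesz_lerDl q0.
Qed.

(** * Disjointness *)

Lemma disjointvC x y : disjointv x y -> disjointv y x.
Proof. by rewrite /disjointv meetC. Qed.

Lemma disjointv0 x : disjointv x 0.
Proof. by rewrite /disjointv rabs0; apply/meet_idPr/rabs_ge0. Qed.

Lemma disjointvN x y : disjointv x y -> disjointv x (- y).
Proof. by rewrite /disjointv rabsN. Qed.

Lemma disjointv_le x y u : disjointv x y -> rabs u <= rabs x -> disjointv u y.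
Proof.
move=> xy ux; apply/le_anti; rewrite lexI !rabs_ge0 andbT -xy.
by rewrite leI2.
Qed.

Lemma disjointvD x y z : disjointv x y -> disjointv x z -> disjointv x (y + z).
Proof.
move=> xy xz; apply/le_anti; rewrite lexI !rabs_ge0 andbT.
rewrite (@le_trans _ _ (rabs x `&` (rabs y + rabs z))%O)//.
  by rewrite leI2 ?ler_rabsD.
by rewrite (le_trans (meetD_le _ _ _))// ?rabs_ge0// xy xz addr0.
Qed.

(** Meeting [rabs x <= rabs (x + y) + rabs y] with [rabs x] and distributing by [meetD_le] kills the
    [rabs y] term. *)
Lemma disjointv_rabsD x y : disjointv x y -> rabs x <= rabs (x + y).
Proof.
move=> xy; have h : rabs x <= rabs (x + y) + rabs y.
  by rewrite -{1}(addrK y x) (le_trans (ler_rabsD _ _))// rabsN.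
rewrite -(meet_idPl h) (le_trans (meetD_le _ _ _)) ?rabs_ge0//.
by rewrite xy addr0 leIr.
Qed.

Lemma disjointv_self x : disjointv x x -> x = 0.
Proof. by rewrite /disjointv meetxx => /rabs_eq0. Qed.

(** * Fragments and their decomposition along a disjoint sum *)

Lemma fragment0 x : fragment 0 x.
Proof. exact/disjointvC/disjointv0. Qed.

Lemma fragmentxx x : fragment x x.
Proof. by rewrite /fragment subrr; exact: disjointv0. Qed.

Lemma fragment_rabs u x : fragment u x -> rabs u <= rabs x.
Proof. by move/disjointv_rabsD; rewrite addrC subrK. Qed.

Lemma fragment_disjointv u v x y :
  disjointv x y -> fragment u x -> fragment v y -> disjointv u v.
Proof.
move=> xy /fragment_rabs ux /fragment_rabs vy.
by apply/(disjointv_le _ ux)/disjointvC/(disjointv_le _ vy)/disjointvC.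
Qed.

Lemma fragmentC u x : fragment u x -> fragment (x - u) x.
Proof. by move=> /disjointvC; rewrite /fragment subKr. Qed.

(** Four pairs must be disjoint: [u], [x - u] and [v], [y - v] by hypothesis, the two mixed pairs
    because [x] and [y] are. *)
Lemma fragmentD u v x y : disjointv x y -> fragment u x -> fragment v y ->
  fragment (u + v) (x + y).
Proof.
move=> xy ux vy; rewrite /fragment opprD addrACA.
have yx := disjointvC xy.
apply/disjointvD; apply/disjointvC/disjointvD.
- exact: disjointvC.
- exact: fragment_disjointv xy (fragmentC ux) vy.
- exact: fragment_disjointv yx (fragmentC vy) ux.
- exact: disjointvC.
Qed.

(** Riesz decomposition splits both [w] and its complement [x + y - w] along [x] and [y]; the parts
    dominated by [x] then turn out to sum to [x], and those dominated by [y] to [y]. *)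
Lemma fragment_decomposition w x y : disjointv x y -> fragment w (x + y) ->
  exists u v, [/\ fragment u x, fragment v y & w = u + v].
Proof.
move=> xy wz; have yx := disjointvC xy.
have decomp t : fragment t (x + y) -> exists u v,
    [/\ t = u + v, rabs u <= rabs x & rabs v <= rabs y].
  move=> /fragment_rabs tz; apply: riesz_decomposition; rewrite ?rabs_ge0//.
  exact: le_trans tz (ler_rabsD _ _).
have [u [v [wE ux vy]]] := decomp _ wz.
have [u' [v' [w'E ux' vy']]] := decomp _ (fragmentC wz).
have disj a b : rabs a <= rabs x -> rabs b <= rabs y -> disjointv a b.
  move=> ax by_.
  exact/(disjointv_le _ ax)/disjointvC/(disjointv_le _ by_)/disjointvC.
have sumE : x - (u + u') = (v + v') - y.
  apply/eqP; rewrite subr_eq addrAC eq_sym subr_eq eq_sym.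
  by rewrite [v + v' + _]addrC addrACA -wE -w'E addrC subrK.
(* The two sides are built from the principal ideals of the disjoint elements
   [x] and [y] respectively, so their common value is disjoint from itself. *)
have xuu'0 : x - (u + u') = 0.
  have xdisj b : rabs b <= rabs y -> disjointv (x - (u + u')) b.
    move=> by_; apply: disjointvC; apply: disjointvD.
      exact/disjointvC/disj.
    apply: disjointvN; apply: disjointvD; exact/disjointvC/disj.
  apply: disjointv_self; rewrite {2}sumE; apply: disjointvD.
    by apply: disjointvD; exact: xdisj.
  by apply: disjointvN; exact: xdisj.
have u'E : x - u = u' by move/eqP: xuu'0; rewrite opprD addrA subr_eq0 => /eqP.
have v'E : y - v = v'.
  move/eqP: sumE; rewrite xuu'0 eq_sym subr_eq0 => /eqP <-.
  by rewrite addrC addKr.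
(* Disjoint summands are dominated by their sum, so [u], [v] inherit from [w], and [u'], [v'] from
   [x + y - w], the disjointness given by [wz]. *)
have uv := disj _ _ ux vy; have uv' := disj _ _ ux' vy'.
have uw : rabs u <= rabs w by rewrite wE disjointv_rabsD.
have vw : rabs v <= rabs w.
  by rewrite wE addrC; exact/disjointv_rabsD/disjointvC.
have uw' : rabs u' <= rabs (x + y - w) by rewrite w'E disjointv_rabsD.
have vw' : rabs v' <= rabs (x + y - w).
  by rewrite w'E addrC; exact/disjointv_rabsD/disjointvC.
exists u, v; split=> //; rewrite /fragment ?u'E ?v'E.
- exact/(disjointv_le _ uw)/disjointvC/(disjointv_le _ uw')/disjointvC.
- exact/(disjointv_le _ vw)/disjointvC/(disjointv_le _ vw')/disjointvC.
Qed.

End RieszTheory.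

(** [supremum] falls back on [x0] for an empty set or when no least upper bound exists; the two
    hypotheses exclude these cases. *)
Lemma supremum_supremums (d : Order.disp_t) (T : porderType d) (x0 : T)
    (A : set T) :
  A !=set0 -> supremums A !=set0 -> supremums A (supremum x0 A).
Proof.
by move=> /set0P/negbTE A0 supA; rewrite /supremum A0; exact: xgetPex.
Qed.

(** * Orthogonally additive operators and the supremum over fragments *)

Section PositivePart.
Set Implicit Arguments.
Unset Strict Implicit.
Context {K : realType} {E F : rieszType K}.
Implicit Types (S T : oao E F) (x y u : E).

Lemma oaoD T x y : disjointv x y -> T (x + y) = T x + T y.
Proof. by move: (oao_funP T) => /asboolP; exact. Qed.

Lemma oao_at0 T : T 0 = 0.
Proof. by apply: (addrI (T 0)); rewrite -oaoD ?addr0//; exact: disjointv0. Qed.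

Lemma oao_fragment T u x : fragment u x -> T x = T u + T (x - u).
Proof. by move=> ux; rewrite -oaoD// addrC subrK. Qed.

Lemma oao_fragment_le T u x :
  (forall y, 0 <= T y) -> fragment u x -> T u <= T x.
Proof. by move=> T0 ux; rewrite (oao_fragment _ ux) riesz_lerDl. Qed.

Section Sup.
Variables (T : oao E F) (R : E -> F).
Hypothesis supR : forall x, supremums (T @` fragments x) (R x).

Let geR x u : fragment u x -> T u <= R x.
Proof. by move=> ux; apply: (supR x).1; exists u. Qed.

Let R_le x c : (forall u, fragment u x -> T u <= c) -> R x <= c.
Proof. by move=> h; apply: (supR x).2 => _ [u ux <-]; exact: h. Qed.

Lemma sup_fragments_ge0 x : 0 <= R x.
Proof. by rewrite -(oao_at0 T); exact/geR/fragment0. Qed.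

Lemma sup_fragments_orthogonally_additive : orthogonally_additive R.
Proof.
move=> x y xy; apply/le_anti/andP; split.
  apply: R_le => w /(fragment_decomposition xy)[u [v [ux vy ->]]].
  by rewrite (oaoD _ (fragment_disjointv xy ux vy)) riesz_lerD ?geR.
(* The two suprema are taken one after the other: with [R y] moved across, first over [u], then over
   [v] with [u] fixed. *)
rewrite -riesz_lerBrDr; apply: R_le => u ux.
rewrite riesz_lerBrDr -riesz_lerBrDl; apply: R_le => v vy.
rewrite riesz_lerBrDl -(oaoD _ (fragment_disjointv xy ux vy)).
exact/geR/fragmentD.
Qed.

Definition sup_fragments_oao : oao E F :=
  Oao (introT (asboolP _) sup_fragments_orthogonally_additive).

Lemma sup_fragments_oaoP : supremums [set T; 0] sup_fragments_oao.
Proof.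
split=> [S [|]/= ->|S ubS].
- by apply/oao_leP => x; exact/geR/fragmentxx.
- by apply/oao_leP => x; exact: sup_fragments_ge0.
have /oao_leP TS : T <= S by apply: ubS; left.
have /oao_leP S0 : 0 <= S by apply: ubS; right.
apply/oao_leP => x; apply: R_le => u ux.
exact/(le_trans (TS u))/oao_fragment_le.
Qed.

Lemma sup_fragments_laterally_bounded :
  laterally_bounded_oao E F sup_fragments_oao.
Proof.
move=> e; exists 0, (R e) => _ [u ue <-] /=; rewrite sup_fragments_ge0/=.
exact: (@oao_fragment_le sup_fragments_oao _ _ sup_fragments_ge0).
Qed.

Lemma sup_fragments_uryson :
  uryson_oao E F T -> uryson_oao E F sup_fragments_oao.
Proof.
move=> bndT A [a [b Aab]].
(* [c] bounds [rabs x] for [a <= x <= b], since [- x <= - a <= rabs a] and [x <= b <= rabs b]. *)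
pose c := (rabs a `|` rabs b)%O.
have [p [q Tpq]] : order_bounded (T @` [set u | rabs u <= c]).
  by apply: bndT; exists (- c), c => u /= /rabs_leP[-> ->].
exists 0, q => _ [x /Aab/= /andP[ax xb] <-] /=; rewrite sup_fragments_ge0/=.
have xc : rabs x <= c.
  have xNa : - x <= rabs a by rewrite (le_trans _ (lerN_rabs a))// riesz_lerN2.
  have xb' : x <= rabs b by exact: le_trans xb (ler_rabs b).
  rewrite /c {1}/rabs leUx.
  by rewrite (le_trans xb' (leUr _ _)) (le_trans xNa (leUl _ _)).
(* A fragment [u] of [x] satisfies [rabs u <= rabs x <= c], so [q] bounds every [T u] and hence
   [R x]. *)
apply: R_le => u /fragment_rabs ux.
have /Tpq/= /andP[]// : (T @` [set u | rabs u <= c]) (T u).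
by exists u => //=; exact: le_trans xc.
Qed.

End Sup.
End PositivePart.

Theorem corollary3p4 (K : realType) (E F : rieszType K) (T : oao E F) :
  (forall x : E, exists s : F, supremums (T @` fragments x) s) ->
  exists Tpos : oao E F,
    [/\ supremums [set T; 0] Tpos,
        forall x : E, Tpos x = supremum 0 (T @` fragments x),
        laterally_bounded_oao E F T -> laterally_bounded_oao E F Tpos
      & uryson_oao E F T -> uryson_oao E F Tpos].
Proof.
move=> exsup.
have supR x : supremums (T @` fragments x) (supremum 0 (T @` fragments x)).
  apply: supremum_supremums => //.
  by exists (T x), x => //; exact: fragmentxx.
exists (sup_fragments_oao supR); split=> //.
- exact: sup_fragments_oaoP.
- by move=> _; exact: sup_fragments_laterally_bounded.
- exact: sup_fragments_uryson.
Qed.
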